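(* Let $X,Y$ be complex Banach spaces, let $\mathcal{B}$ be a non-empty collection of non-empty subsets of $X$ such that every $x\in X$ belongs to some $B\in\mathcal{B}$, and let $c\in\mathbb{C}$ with $|c|=1$ and $\arg(c)=\pi p/q$, where $p\in\mathbb{Z}\setminus\{0\}$, $q\in\mathbb{N}$ and $(p,q)=1$ (i.e. $p$ and $q$ are coprime). Let $\emptyset\neq I'\subseteq I\subseteq\mathbb{R}^n$ with $I+I'\subseteq I$, and suppose that $F:I\times X\to Y$ is Bohr $(\mathcal{B},I',c)$-almost periodic (respectively, $(\mathcal{B},I',c)$-uniformly recurrent). Put $qI':=\{q\mathbf{t}:\mathbf{t}\in I'\}$. Then: (i) if $p$ is even, then $F$ is Bohr $(\mathcal{B},qI')$-almost periodic (respectively, $(\mathcal{B},qI')$-uniformly recurrent); (ii) if $p$ is odd, then $F$ is Bohr $(\mathcal{B},qI')$-almost anti-periodic (respectively, $(\mathcal{B},qI')$-uniformly anti-recurrent).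
   Context: Here $n\in\mathbb{N}=\{1,2,\dots\}$, $|\cdot|$ is the Euclidean norm on $\mathbb{R}^n$ and $B(\mathbf{t}_0,l):=\{\mathbf{t}\in\mathbb{R}^n:|\mathbf{t}-\mathbf{t}_0|\le l\}$. Let $\emptyset\neq J\subseteq I\subseteq\mathbb{R}^n$ with $I+J\subseteq I$, let $d\in\mathbb{C}\setminus\{0\}$ and let $F:I\times X\to Y$ be continuous. $F$ is Bohr $(\mathcal{B},J,d)$-almost periodic if for every $B\in\mathcal{B}$ and $\epsilon>0$ there exists $l>0$ such that for each $\mathbf{t}_0\in J$ there exists $\tau\in B(\mathbf{t}_0,l)\cap J$ such that $\|F(\mathbf{t}+\tau;x)-dF(\mathbf{t};x)\|_Y\le\epsilon$ for all $\mathbf{t}\in I$, $x\in B$. $F$ is $(\mathcal{B},J,d)$-uniformly recurrent if for every $B\in\mathcal{B}$ there exists a sequence $(\tau_k)$ in $J$ such that $\lim_{k\to+\infty}|\tau_k|=+\infty$ and $\lim_{k\to+\infty}\sup_{\mathbf{t}\in I,\,x\in B}\|F(\mathbf{t}+\tau_k;x)-dF(\mathbf{t};x)\|_Y=0$. ''Bohr $(\mathcal{B},J)$-almost periodic'' and ''$(\mathcal{B},J)$-uniformly recurrent'' mean, respectively, Bohr $(\mathcal{B},J,1)$-almost periodic and $(\mathcal{B},J,1)$-uniformly recurrent (that is, $d=1$); ''Bohr $(\mathcal{B},J)$-almost anti-periodic'' and ''$(\mathcal{B},J)$-uniformly anti-recurrent'' mean, respectively, Bohr $(\mathcal{B},J,-1)$-almost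 periodic and $(\mathcal{B},J,-1)$-uniformly recurrent (that is, $d=-1$). *)

(* Defs.v *)
From HB Require Import structures.
From mathcomp Require Import all_boot all_order all_algebra.
From mathcomp Require Import all_classical all_reals all_analysis.
From mathcomp Require Export complex.
Set Implicit Arguments.
Unset Strict Implicit.
Unset Printing Implicit Defensive.
Import Order.TTheory GRing.Theory Num.Theory.
Import numFieldNormedType.Exports.
Local Open Scope classical_set_scope.
Local Open Scope ring_scope.
Local Open Scope complex_scope.

(* The library norm on 'rV[R]_n is the sup norm; it induces the same topology
   as [enorm], so continuity below is unaffected. *)
Definition enorm (R : realType) (n : nat) (t : 'rV[R]_n) : R :=
  Num.sqrt (\sum_(i < n) t ord0 i ^+ 2).

(* Closed, unlike the library's [ball]. *)
Definition eball (R : realType) (n : nat) (t0 : 'rV[R]_n) (l : R) :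
  set 'rV[R]_n := [set t | enorm (t - t0) <= l].

(* The norm of a normed module over R[i] takes its values in the nonnegative
   reals of R[i]; [rnorm] reads it as an element of R. *)
Definition rnorm (R : realType) (Y : normedModType R[i]) (y : Y) : R :=
  complex.Re `|y|.

(* [theta] is a (not necessarily principal) argument of [c]. *)
Definition is_arg (R : realType) (c : R[i]) (theta : R) : Prop :=
  c = `|c| * (cos theta +i* sin theta).

Section AlmostPeriodicity.
Variables (R : realType) (n : nat) (X Y : completeNormedModType R[i]).
Implicit Types (I J : set 'rV[R]_n) (F : 'rV[R]_n -> X -> Y).

Definition admissible_pair I J : Prop :=
  [/\ J !=set0, J `<=` I & forall t s, I t -> J s -> I (t + s)].

(* A function I * X -> Y is represented by a total F whose values at t outside
   I are never used; continuity is with respect to the subspace topology. *)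
Definition continuous_on_dom I F : Prop :=
  {within I `*` [set: X], continuous (fun z : 'rV[R]_n * X => F z.1 z.2)}.

Definition standing I J (d : R[i]) F : Prop :=
  [/\ admissible_pair I J, d != 0 & continuous_on_dom I F].

Definition Bohr_almost_periodic_d
    I (BB : set (set X)) J (d : R[i]) F : Prop :=
  standing I J d F /\
  forall B, BB B -> forall eps : R, 0 < eps ->
    exists2 l : R, 0 < l &
      forall t0, J t0 ->
        exists2 tau, (eball t0 l `&` J) tau &
          forall t x, I t -> B x -> rnorm (F (t + tau) x - d *: F t x) <= eps.

(* The supremum lives in \bar R: it may be +oo for finitely many k. *)
Definition uniformly_recurrent_d
    I (BB : set (set X)) J (d : R[i]) F : Prop :=
  standing I J d F /\
  forall B, BB B ->
    exists tau : nat -> 'rV[R]_n,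
      [/\ forall k, J (tau k),
          (fun k => enorm (tau k)) @ \oo --> +oo &
          (fun k => ereal_sup
             [set (rnorm (F (z.1 + tau k) z.2 - d *: F z.1 z.2))%:E
                | z in I `*` B]) @ \oo --> 0%E].

Definition Bohr_almost_periodic I BB J F := Bohr_almost_periodic_d I BB J 1 F.

Definition uniformly_recurrent I BB J F := uniformly_recurrent_d I BB J 1 F.

Definition Bohr_almost_anti_periodic I BB J F :=
  Bohr_almost_periodic_d I BB J (-1) F.

Definition uniformly_anti_recurrent I BB J F :=
  uniformly_recurrent_d I BB J (-1) F.

End AlmostPeriodicity.

(* Main.v *)
(* As |c| = 1, telescoping
     F(t + q tau) - c^q F(t)
       = sum_(j < q) c^(q-1-j) (F(t + (j+1) tau) - c F(t + j tau))
   turns an eps-bound for the shift tau into a (q eps)-bound for the shift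
   q tau with multiplier c^q; and c^q = exp(i pi p) = (-1)^p. *)
Require Import Defs.
From HB Require Import structures.
From mathcomp Require Import all_boot all_order all_algebra.
From mathcomp Require Import all_classical all_reals all_analysis.
From mathcomp Require Import complex.
Set Implicit Arguments.
Unset Strict Implicit.
Unset Printing Implicit Defensive.
Import Order.TTheory GRing.Theory Num.Theory.
Import numFieldNormedType.Exports.
Local Open Scope classical_set_scope.
Local Open Scope ring_scope.
Local Open Scope complex_scope.

Section RealNorm.
Variables (R : realType) (Y : normedModType R[i]).

Lemma rnorm_ge0 (y : Y) : 0 <= rnorm y.
Proof. by have := normr_ge0 y; rewrite /rnorm lecE => /andP[]. Qed.

Lemma rnormD (y z : Y) : rnorm (y + z) <= rnorm y + rnorm z.
Proof.
(* In [R[i]], [<=] means equal imaginary parts and ordered real parts; only the second conjunct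
   matters here. *)
have := ler_normD y z; rewrite /rnorm lecE => /andP[_].
by case: `|y| => ? ?; case: `|z| => ? ?.
Qed.

Lemma rnormZ1 (c : R[i]) (y : Y) : `|c| = 1 -> rnorm (c *: y) = rnorm y.
Proof. by move=> c1; rewrite /rnorm normrZ c1 mul1r. Qed.

End RealNorm.

Lemma enormZ_nat (R : realType) (n q : nat) (t : 'rV[R]_n) :
  enorm (q%:R *: t) = q%:R * enorm t.
Proof.
rewrite /enorm -[X in X * _]ger0_norm// -sqrtr_sqr -sqrtrM ?sqr_ge0//.
by rewrite mulr_sumr; congr Num.sqrt; apply: eq_bigr => i _; rewrite !mxE exprMn.
Qed.

Section Cis.
Variable R : realType.

Definition cis (x : R) : R[i] := cos x +i* sin x.

Lemma cis_natmul (x : R) (k : nat) : cis (x *+ k) = cis x ^+ k.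
Proof.
elim: k => [|k IHk]; first by rewrite mulr0n /cis cos0 sin0.
rewrite exprS -IHk mulrS /cis cosD sinD.
by apply/eqP; rewrite eq_complex /= [X in _ && (X == _)]addrC !eqxx.
Qed.

Lemma cis_pi_int (p : int) : cis (pi * p%:~R) = (-1) ^+ `|p|%N.
Proof.
have cispi (k : nat) : cis (pi *+ k) = (-1) ^+ k.
  rewrite cis_natmul /cis cospi sinpi; congr (_ ^+ _).
  by apply/eqP; rewrite eq_complex /= oppr0 !eqxx.
case: p => k; first by rewrite -pmulrn mulr_natr cispi.
rewrite NegzE abszN absz_nat -cispi mulrNz mulrN -pmulrn mulr_natr.
(* For negative [p], [cis] gets conjugated. This changes nothing, since the value at [pi *+ k.+1] is
   a power of -1 and so has zero imaginary part. *)
have s0 : sin (pi *+ k.+1) = 0 :> R.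
  have /(congr1 (@complex.Im R)) /= := cispi k.+1; move=> ->.
  by rewrite -signr_odd; case: odd; rewrite /= ?oppr0.
by rewrite /cis cosN sinN s0 oppr0.
Qed.

(** By de Moivre, raising to the power [q] multiplies the argument by [q], which cancels the
    denominator and leaves [cis (pi * p)]. *)
Lemma is_arg_expr (c : R[i]) (p : int) (q : nat) :
    (0 < q)%N -> `|c| = 1 -> is_arg c (pi * p%:~R / q%:R) ->
  c ^+ q = (-1) ^+ `|p|%N.
Proof.
rewrite /is_arg => q0 ->; rewrite mul1r -/(cis _) => ->.
rewrite -cis_natmul -[_ *+ q]mulr_natr divfK ?cis_pi_int//.
by rewrite pnatr_eq0 -lt0n.
Qed.

End Cis.

Section Powers.
Variables (R : realType) (n : nat) (X Y : completeNormedModType R[i]).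
Variables (I J : set 'rV[R]_n) (F : 'rV[R]_n -> X -> Y) (c : R[i]) (q : nat).
Hypotheses (IJ : forall t s, I t -> J s -> I (t + s)) (c1 : `|c| = 1).

Lemma add_natmul_closed (k : nat) t s : I t -> J s -> I (t + k%:R *: s).
Proof.
move=> It Js; elim: k => [|k IHk]; first by rewrite scale0r addr0.
by rewrite -natr1 scalerDl scale1r addrA; exact: IJ.
Qed.

(** Induction on [k]: the difference for [k + 1] is the last summand plus [c] times the difference
    for [k], and multiplying by [c] preserves the norm because [|c| = 1]. *)
Lemma rnorm_telescope (k : nat) t s x :
  rnorm (F (t + k%:R *: s) x - c ^+ k *: F t x) <=
  \sum_(j < k) rnorm (F (t + j%:R *: s + s) x - c *: F (t + j%:R *: s) x).
Proof.
elim: k => [|k IHk].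
  by rewrite big_ord0 scale0r addr0 expr0 scale1r subrr /rnorm normr0.
rewrite big_ord_recr /=; apply: le_trans (lerD IHk (lexx _)).
rewrite -[leRHS]addrC -(rnormZ1 (F (t + k%:R *: s) x - _) c1).
apply: le_trans (rnormD _ _); rewrite le_eqVlt; apply/orP; left; apply/eqP.
congr rnorm; rewrite -natr1 [in LHS]scalerDl scale1r addrA scalerBr scalerA -exprS.
by rewrite addrA subrK.
Qed.

Hypothesis q0 : (0 < q)%N.

Let qJ := [set q%:R *: t | t in J].

Lemma standing_natmul : standing I J c F -> standing I qJ (c ^+ q) F.
Proof.
move=> [[[t0 Jt0] JI _] cn0 Fc]; split => //; last by rewrite expf_neq0.
split; first by exists (q%:R *: t0), t0.
(* Write [q t = t + (q - 1) t]: the first [t] is a point of [I], the other copies are shifts from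
   [J]. *)
- move=> _ [t Jt <-]; rewrite -(prednK q0) -nat1r scalerDl scale1r.
  by apply: add_natmul_closed => //; exact: JI.
- by move=> t _ It [s Js <-]; exact: add_natmul_closed.
Qed.

(** Almost periodicity is applied with [e / q], so that the [q] telescoped terms add up to [e]. The
    radius becomes [q * l] because centres and shifts are both dilated by [q]. *)
Lemma Bohr_almost_periodic_natmul (BB : set (set X)) :
  Bohr_almost_periodic_d I BB J c F ->
  Bohr_almost_periodic_d I BB qJ (c ^+ q) F.
Proof.
have q0' : 0 < q%:R :> R by rewrite ltr0n.
move=> [st ap]; split; first exact: standing_natmul.
move=> B BBB e e0; have [l l0 H] := ap B BBB _ (divr_gt0 e0 q0').
exists (q%:R * l); first exact: mulr_gt0.
move=> _ [t0 Jt0 <-]; have [tau [tl Jtau] Htau] := H t0 Jt0.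
exists (q%:R *: tau).
  split; last by exists tau.
  by rewrite /eball /= -scalerBr enormZ_nat ler_pM2l.
move=> t x It Bx; apply: le_trans (rnorm_telescope _ _ _ _) _.
apply: (@le_trans _ _ (\sum_(j < q) (e / q%:R))).
  by apply: ler_sum => j _; apply: Htau => //; exact: add_natmul_closed.
by rewrite sumr_const card_ord -[_ *+ q]mulr_natr divfK// gt_eqF.
Qed.

(** The shifts [q tau_k] work: their suprema are squeezed between 0 and [q] times the suprema for
    [tau_k]. *)
Lemma uniformly_recurrent_natmul (BB : set (set X)) :
    (forall B, BB B -> B !=set0) ->
  uniformly_recurrent_d I BB J c F ->
  uniformly_recurrent_d I BB qJ (c ^+ q) F.
Proof.
have q0' : 0 < q%:R :> R by rewrite ltr0n.
move=> BBne [st ur]; split; first exact: standing_natmul.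
move=> B BBB; have [tau [Jtau taoo sup0]] := ur B BBB.
exists (fun k => q%:R *: tau k); split.
- by move=> k; exists (tau k).
- under eq_fun do rewrite enormZ_nat.
  apply: (cvg_comp _ _ taoo); exact: gt0_cvgMry q0' cvg_id.
set s := fun k => ereal_sup _ in sup0.
have [[[t0 Jt0] JI _] _ _] := st; have [x0 Bx0] := BBne B BBB.
apply: (@squeeze_cvge _ _ _ _ (cst 0%E) _ (fun k => q%:R%:E * s k)%E).
- apply: nearW => k; apply/andP; split.
    (* A supremum over the empty set would be [-oo]; the point [(t0, x0)] of [I * B] gives the lower
       bound 0. *)
    apply: ereal_sup_ge; eexists.
      by exists (t0, x0) => //; split => //; exact: JI.
    by rewrite lee_fin rnorm_ge0.
  apply: ge_ereal_sup => _ [[t x] [/= It Bx] <-].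
  apply: (@le_trans _ _ (\sum_(j < q) s k)%E); last first.
    by rewrite sumr_const card_ord mule_natl.
  (* Each telescoped term is a value at the point [t + j tau_k], again in [I], so the same supremum
     [s k] bounds all [q] of them. *)
  have := rnorm_telescope q t (tau k) x; rewrite -lee_fin => /le_trans; apply.
  rewrite -sumEFin; apply: lee_sum => j _; apply: ereal_sup_ubound.
  exists (t + j%:R *: tau k, x) => //; split => //=.
  exact: add_natmul_closed.
- exact: cvg_cst.
- rewrite -[X in _ --> X](mule0 q%:R%:E); exact: cvgeZl.
Qed.

End Powers.

Local Close Scope complex_scope.

Theorem corollary2p14 (R : realType) (n : nat) (hn : (0 < n)%N)
    (X Y : completeNormedModType R[i])
    (BB : set (set X)) (hBB0 : BB !=set0)
    (hBBne : forall B, BB B -> B !=set0)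
    (hBBcover : forall x : X, exists2 B, BB B & B x)
    (c : R[i]) (hc : `|c| = 1)
    (p : int) (hp : p != 0) (q : nat) (hq : (0 < q)%N)
    (hpq : coprimez p q%:Z)
    (harg : is_arg c (pi * p%:~R / q%:R))
    (I I' : set 'rV[R]_n) (hI'0 : I' !=set0) (hI'I : I' `<=` I)
    (hadd : forall t s, I t -> I' s -> I (t + s))
    (F : 'rV[R]_n -> X -> Y) :
  let qI' := [set q%:R *: t | t in I'] in
  (Bohr_almost_periodic_d I BB I' c F ->
     ((2 %| p)%Z -> Bohr_almost_periodic I BB qI' F) /\
     (~~ (2 %| p)%Z -> Bohr_almost_anti_periodic I BB qI' F)) /\
  (uniformly_recurrent_d I BB I' c F ->
     ((2 %| p)%Z -> uniformly_recurrent I BB qI' F) /\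
     (~~ (2 %| p)%Z -> uniformly_anti_recurrent I BB qI' F)).
Proof.
move=> qI'; have cq := is_arg_expr hq hc harg.
(* The sign of [p] does not affect its parity, so the parity of the exponent [|p|] decides between
   [c ^+ q = 1] and [c ^+ q = -1]. *)
have odd_p : (2 %| p)%Z = ~~ odd `|p|%N by rewrite dvdzE dvdn2.
have cq_even : (2 %| p)%Z -> c ^+ q = 1.
  by rewrite odd_p cq -signr_odd => /negbTE ->.
have cq_odd : ~~ (2 %| p)%Z -> c ^+ q = -1.
  by rewrite odd_p negbK cq -signr_odd => ->.
split=> HF.
- have HFq := Bohr_almost_periodic_natmul hadd hc hq HF.
  by split => [/cq_even|/cq_odd] e; rewrite e in HFq.
- have HFq := uniformly_recurrent_natmul hadd hc hq hBBne HF.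
  by split => [/cq_even|/cq_odd] e; rewrite e in HFq.
Qed.
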